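(* Let $-1\le q<1$, let $\mathcal H$ be a real Hilbert space, and let $f,g,h\in\mathcal H$ be unit vectors such that $f,h$ are linearly independent. Suppose that $(\tilde X,\tilde Y,\tilde Z)$ is a classical version of the $q$-Gaussian triplet $(\mathbf X,\mathbf Y,\mathbf Z):=(\mathbf X_f,\mathbf X_g,\mathbf X_h)$ (in this order). If either $$\langle f,g\rangle\langle g,h\rangle\le\langle f,h\rangle\quad\text{and}\quad 0<\langle f,h\rangle<1,$$ or $\langle f,h\rangle=0$, or $q=-1$, then $$1-\langle f,h\rangle\ \ge\ \left|\langle f,g\rangle-\langle g,h\rangle\right|.$$
   Context: $q$-Fock space. Let $\mathcal H$ be a real Hilbert space with complexification $\mathcal H_c$. The $q$-Fock space $\Gamma_q(\mathcal H)$ is the completion of the algebraic direct sum $\mathbb C\Phi\oplus\bigoplus_{n\ge1}\mathcal H_c^{\otimes n}$ ($\Phi$ is a unit vector, the vacuum) in the scalar product $$\langle f_1\otimes\dots\otimes f_n|g_1\otimes\dots\otimes g_m\rangle_q=\begin{cases}\sum_{\sigma\in S_n}q^{|\sigma|}\prod_{j=1}^n\langle f_j,g_{\sigma(j)}\rangle & m=n\\ 0& m\ne n,\end{cases}$$ where $S_n$ is the set of permutations of $\{1,\dots,n\}$ and $|\sigma|=\#\{(i,j):i<j,\ \sigma(i)>\sigma(j)\}$. This form is known to be positive definite for $-1<q<1$; for $q=-1$ it is only non-negative definite, and one first takes the quotient by its null vectors (which gives the fermionic Fock space). For $f\in\mathcal H$, the operator $\mathbf a_f$ on $\Gamma_q(\mathcal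 H)$ is given by $\mathbf a_f\Phi=0$ and $\mathbf a_f\, f_1\otimes\dots\otimes f_n=\sum_{j=1}^n q^{j-1}\langle f,f_j\rangle f_1\otimes\dots\otimes f_{j-1}\otimes f_{j+1}\otimes\dots\otimes f_n$; its adjoint is given by $\mathbf a_f^*\Phi=f$ and $\mathbf a_f^*\, f_1\otimes\dots\otimes f_n=f\otimes f_1\otimes\dots\otimes f_n$. These are bounded operators satisfying $\mathbf a_f\mathbf a_g^*-q\,\mathbf a_g^*\mathbf a_f=\langle f,g\rangle\mathbf I$. Put $\mathbf X_f=\mathbf a_f+\mathbf a_f^*$. Let $\mathcal A$ be the algebra generated by all $\mathbf X_f$, $f\in\mathcal H$, with vacuum state $\mathbb E(\mathbf T)=\langle\Phi|\mathbf T\Phi\rangle_q$. Classical version. An ordered triplet $(\mathbf X,\mathbf Y,\mathbf Z)$ of such operators has a classical version $(\tilde X,\tilde Y,\tilde Z)$ if $\tilde X,\tilde Y,\tilde Z$ are real random variables on a classical probability space, with expectation $E$, such that $\mathbb E(P_1(\mathbf X)P_2(\mathbf Y)P_3(\mathbf Z))=E(P_1(\tilde X)P_2(\tilde Y)P_3(\tilde Z))$ for all polynomials $P_1,P_2,P_3$. *)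

(* Defs.v *)
From HB Require Import structures.
From mathcomp Require Import all_boot all_order all_algebra.
From mathcomp Require Import perm sesquilinear complex.
From mathcomp Require Import all_classical all_reals all_analysis.
Set Implicit Arguments.
Unset Strict Implicit.
Unset Printing Implicit Defensive.
Import Order.TTheory GRing.Theory Num.Theory.
Import numFieldNormedType.Exports.
Local Open Scope classical_set_scope.
Local Open Scope complex_scope.
Local Open Scope ring_scope.

(* Use theta = idfun for real and theta = Num.conj for complex scalars. *)
Record hilbertType (K : numFieldType) (theta : K -> K) := Hilbert {
  hilbert_sort :> completeNormedModType K ;
  hilbert_dot : {dot hilbert_sort for theta} ;
  hilbert_normE : forall x : hilbert_sort, `|x| ^+ 2 = hilbert_dot x x }.

(* MathComp forms are linear in the first argument and theta-linear in the
   second; braket is linear in the second argument instead. *)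
Definition braket (K : numFieldType) (theta : K -> K) (V : hilbertType theta)
  (x y : V) : K := hilbert_dot V y x.

Notation realHilbertType R := (@hilbertType R (@idfun R)).
Notation complexHilbertType R := (@hilbertType R[i] (@Num.conj R[i])).

(* The pair (x, y) stands for x + i y. *)
Definition complexification (R : realType) (V : lmodType R) : Type :=
  (V * V)%type.

Section Complexification.
Context {R : realType} {V : lmodType R}.
Local Notation VC := (complexification V).

HB.instance Definition _ := GRing.Zmodule.copy VC (V * V)%type.

Definition complexification_scale (c : R[i]) (u : VC) : VC :=
  (complex.Re c *: u.1 - complex.Im c *: u.2,
   complex.Im c *: u.1 + complex.Re c *: u.2).

Fact complexification_scaleA a b u : complexification_scale a
    (complexification_scale b u) = complexification_scale (a * b) u.
Proof.
case: a b u => [a a'] [b b'] [x y]; rewrite /complexification_scale /=.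
congr (_, _).
  by rewrite scalerBr scalerDr !scalerA scalerBl scalerDl !opprD addrACA.
rewrite scalerBr scalerDr !scalerA scalerBl scalerDl addrACA.
by rewrite [_ *: x + _]addrC [- _ + _]addrC.
Qed.

Fact complexification_scale1 : left_id 1 complexification_scale.
Proof.
by case=> x y; rewrite /complexification_scale /= !scale1r !scale0r subr0 add0r.
Qed.

Fact complexification_scaleDr :
  right_distributive complexification_scale +%R.
Proof.
case=> a b [x y] [z t]; rewrite /complexification_scale /=.
rewrite !(scalerDr, opprD).
by congr pair; rewrite /= addrACA.
Qed.

Fact complexification_scaleDl u :
  {morph complexification_scale^~ u : a b / a + b}.
Proof.
case: u => x y [a a'] [b b']; rewrite /complexification_scale /=.
rewrite !(scalerDl, opprD).
by congr pair; rewrite /= addrACA.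
Qed.

HB.instance Definition _ := GRing.Zmodule_isLmodule.Build R[i] VC
  complexification_scaleA complexification_scale1
  complexification_scaleDr complexification_scaleDl.

End Complexification.

Section QFock.
Context {R : realType} (q : R) (H : realHilbertType R).
Local Notation Hc := (complexification H).

Definition real_vector (f : H) : Hc := (f, 0).

Definition complexification_braket (u v : Hc) : R[i] :=
  (braket u.1 v.1 + braket u.2 v.2) +i* (braket u.1 v.2 - braket u.2 v.1).

Definition inversions n (s : 'S_n) : nat :=
  #|[pred p : 'I_n * 'I_n | (p.1 < p.2)%N && (s p.2 < s p.1)%N]|.

Definition qform (u v : seq Hc) : R[i] :=
  if size u == size v then
    \sum_(s : 'S_(size u)) (q ^+ inversions s)%:C *
      \prod_(j < size u) complexification_braket u`_j v`_(s j)
  else 0.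

(* The q-Fock space over H, presented by its defining property: a complex
   Hilbert space with elementary tensors [fock_tensor [:: f_1; ..; f_n]]
   (the empty word being the vacuum) that are multilinear, have the q-deformed
   scalar products and span a dense subspace. This determines the completion
   of the algebraic direct sum up to a unique unitary preserving the tensors;
   since the scalar product of [fock_sort] is definite, null vectors of the
   q-form (which exist for q = -1) are identified with 0. *)
Record qFock := QFock {
  fock_sort :> complexHilbertType R ;
  fock_tensor : seq Hc -> fock_sort ;
  fock_tensor_linear : forall (u v : seq Hc) (c : R[i]) (x y : Hc),
    fock_tensor (u ++ (c *: x + y) :: v) =
    c *: fock_tensor (u ++ x :: v) + fock_tensor (u ++ y :: v) ;
  fock_braketE : forall u v : seq Hc,
    braket (fock_tensor u) (fock_tensor v) = qform u v ;
  fock_dense : dense [set x : fock_sort | exists l : seq (R[i] * seq Hc),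
    x = \sum_(p <- l) p.1 *: fock_tensor p.2] }.

Definition vacuum (G : qFock) : G := fock_tensor G [::].

(* The bounded operators a_f and their adjoints; each is determined by its
   action on elementary tensors together with continuity. *)
Record fock_operators (G : qFock) := FockOperators {
  annihilation : H -> {linear G -> G} ;
  creation : H -> {linear G -> G} ;
  annihilation_continuous : forall f, continuous (annihilation f) ;
  creation_continuous : forall f, continuous (creation f) ;
  annihilationE : forall f (u : seq Hc),
    annihilation f (fock_tensor G u) =
    \sum_(j < size u)
      ((q ^+ j)%:C * complexification_braket (real_vector f) u`_j) *:
        fock_tensor G (take j u ++ drop j.+1 u) ;
  creationE : forall f (u : seq Hc),
    creation f (fock_tensor G u) = fock_tensor G (real_vector f :: u) ;
  creation_adjoint : forall f (x y : G),
    braket (creation f x) y = braket x (annihilation f y) }.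

Definition qgaussian (G : qFock) (a : fock_operators G) (f : H) (x : G) : G :=
  annihilation a f x + creation a f x.

Definition vacuum_state (G : qFock) (T : G -> G) : R[i] :=
  braket (vacuum G) (T (vacuum G)).

End QFock.

Definition op_horner (R : realType) (V : lmodType R[i]) (p : {poly R})
  (T : V -> V) (v : V) : V :=
  \sum_(i < size p) (p`_i)%:C *: iter i T v.

Definition classical_version (R : realType) (q : R) (H : realHilbertType R)
  (G : qFock q H) (TX TY TZ : G -> G) (d : measure_display)
  (Omega : measurableType d) (P : probability Omega R)
  (X Y Z : {RV P >-> R}) : Prop :=
  forall p1 p2 p3 : {poly R},
    let F : Omega -> R := fun w => p1.[X w] * p2.[Y w] * p3.[Z w] in
    P.-integrable setT (EFin \o F) /\
    vacuum_state (op_horner p1 TX \o op_horner p2 TY \o op_horner p3 TZ) =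
      (fine 'E_P[F]%E)%:C.

(* Main.v *)
Require Import Defs.
From HB Require Import structures.
From mathcomp Require Import all_boot all_order all_algebra.
From mathcomp Require Import perm sesquilinear complex.
From mathcomp Require Import all_classical all_reals all_analysis.
From mathcomp Require Import measurable_realfun ring lra zify.
Import Order.TTheory GRing.Theory Num.Theory.
Import numFieldNormedType.Exports.
Local Open Scope ring_scope.

(* Write al = <f,g>, be = <g,h>, c = <f,h>. For q = -1 the variables are signs
   almost surely and the classical argument of Bell applies. Let -1 < q and
   0 <= c < 1, and put al = a + b c, be = a c + b, so that the claim reads
   |a - b| <= 1. In the q-Fock space E(Y | X, Z) = a X + b Z and
     Var(Y | X, Z) = s + a b (1 - q) / (1 - q c^2) W,
     W = (c X - Z) (X - c Z) - c (1 - c^2),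
   with s = 1 - a^2 - b^2 - 2 a b c. Since E W = 0, s >= 0, which is enough if
   a b >= 0. Otherwise, since W >= - (1 + c)^2 X Z - c (1 - c^2), positivity of
   the conditional variance gives the claim as soon as - X Z takes values as
   large as 2 / (1 - q) (half of its supremum). This is seen by testing against
   phi^2, where phi is a product of two sums of four consecutive normalized
   orthogonal polynomials of high degree: q-Hermite polynomials in X, and, with
   alternating signs, the Al-Salam-Chihara polynomials of the conditional law
   of Z given X. *)

Set Implicit Arguments.
Unset Strict Implicit.
Unset Printing Implicit Defensive.

(** * q-numbers and q-Hermite polynomials *)

Section QNumbers.
Context {R : comNzRingType} (q : R).

Definition qnum n : R := \sum_(i < n) q ^+ i.

Lemma qnum0 : qnum 0 = 0. Proof. exact: big_ord0. Qed.

Lemma qnumSr n : qnum n.+1 = qnum n + q ^+ n.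
Proof. exact: big_ord_recr. Qed.

Lemma qnumSl n : qnum n.+1 = 1 + q * qnum n.
Proof.
rewrite /qnum big_ord_recl expr0 mulr_sumr; congr (_ + _).
by apply: eq_bigr => i _; rewrite exprS.
Qed.

Lemma qnumD m n : qnum (m + n) = qnum m + q ^+ m * qnum n.
Proof.
elim: n => [|n IHn]; first by rewrite addn0 qnum0 mulr0 addr0.
by rewrite addnS !qnumSr IHn exprD; ring.
Qed.

Lemma mulr_subq1_qnum n : (1 - q) * qnum n = 1 - q ^+ n.
Proof.
elim: n => [|n IHn]; first by rewrite qnum0 mulr0 subrr.
by rewrite qnumSr mulrDr IHn exprS; ring.
Qed.

Definition qfact n : R := \prod_(i < n) qnum i.+1.

Lemma qfactS n : qfact n.+1 = qnum n.+1 * qfact n.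
Proof. by rewrite /qfact big_ord_recr mulrC. Qed.

(** The q-falling factorial [k][k-1]...[k-n+1]. The truncated predecessor is harmless: a factor
    [qnum 0] makes the product vanish as soon as n > k. *)
Fixpoint qfalling k n : R :=
  if n is n'.+1 then qnum k * qfalling k.-1 n' else 1.

Lemma qfallingSr k n : qfalling k n.+1 = qfalling k n * qnum (k - n).
Proof.
elim: n k => [|n IHn] k; first by rewrite /= mulr1 mul1r subn0.
by rewrite [LHS]/= -/(qfalling k.-1 n.+1) IHn /= mulrA -subn1 -subnDA add1n.
Qed.

Lemma qfalling_small k n : (k < n)%N -> qfalling k n = 0.
Proof.
elim: n k => // n IHn [|k] lt_kn /=; first by rewrite qnum0 mul0r.
by rewrite IHn ?mulr0.
Qed.

(* [<f^k, h^n>_q] for tensor powers of vectors with [<f, h> = c]. *)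
Definition qcov (c : R) k n : R := if k == n then c ^+ n * qfact n else 0.

(** One creation operator is moved across the scalar product, using a_f h^n = c [n] h^(n-1). At n =
    0 the factor [0] absorbs the truncated predecessor. *)
Lemma qcovSl c k n : qcov c k.+1 n = c * qnum n * qcov c k n.-1.
Proof.
case: n => [|n]; first by rewrite qnum0 mulr0 mul0r.
rewrite /qcov eqSS; case: eqP => _; last by rewrite mulr0.
by rewrite exprS qfactS; ring.
Qed.

Lemma qcovC c k n : qcov c k n = qcov c n k.
Proof. by rewrite /qcov eq_sym; case: eqP => // ->. Qed.

Lemma qcovSr c k n : qcov c k n.+1 = c * qnum k * qcov c k.-1 n.
Proof. by rewrite qcovC qcovSl qcovC. Qed.

End QNumbers.

Section HermitePoly.
Context {R : comNzRingType} (q : R).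

(** Monic continuous q-Hermite polynomials, scaled so that H_n(X_f) maps the vacuum to the n-th
    tensor power of a unit vector f. *)
Fixpoint hermite n : {poly R} :=
  if n is m.+1 then
    'X * hermite m - (if m is k.+1 then (qnum q m)%:P * hermite k else 0)
  else 1.

Lemma hermite_rec n :
  'X * hermite n = hermite n.+1 + (qnum q n)%:P * hermite n.-1.
Proof.
case: n => [|n]; last by rewrite /= subrK.
by rewrite qnum0 mul0r /= subr0 addr0.
Qed.

Lemma hermiteS n :
  hermite n.+1 = 'X * hermite n - (qnum q n)%:P * hermite n.-1.
Proof. by rewrite hermite_rec addrK. Qed.

(** By the recurrence, X H_n is a combination of H_{n+1} and H_{n-1}; hence F kills every X^m H_n,
    and n = 0 gives the monomials. *)
Lemma hermite_span (F : {poly R} -> R) :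
  (forall r p s, F (r%:P * p + s) = r * F p + F s) ->
  (forall n, F (hermite n) = 0) -> forall p, F p = 0.
Proof.
move=> F_lin F_herm.
have F0 : F 0 = 0 by have := F_lin (-1) 0 0; rewrite mulr0 addr0 mulN1r addNr.
have FXn m n : F ('X^m * hermite n) = 0.
  elim: m n => [|m IHm] n; first by rewrite mul1r.
  rewrite exprSr -mulrA hermite_rec mulrDr mulrCA addrC F_lin !IHm.
  by rewrite mulr0 addr0.
move=> p; rewrite -(coefK p) poly_def.
elim/big_ind: _ => [//|s t Fs Ft|i _].
  by rewrite -[s]mul1r F_lin Fs Ft mulr0 addr0.
rewrite -mul_polyC -['X^_]mulr1 -[1]/(hermite 0) -[X in F X]addr0.
by rewrite F_lin FXn F0 mulr0 addr0.
Qed.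

End HermitePoly.
Arguments hermite : simpl never.

(** * Conditional moments *)

Section BivariateFunctional.
Context {R : comNzRingType}.

(* Polynomials in [x = 'X%:P] and [z = 'X]. *)
Definition poly2_functional (L : {poly {poly R}} -> R) :=
  forall r P P', L (r%:P%:P * P + P') = r * L P + L P'.

Context (L : {poly {poly R}} -> R) (L_lin : poly2_functional L).

Lemma functional0 : L 0 = 0.
Proof. by have := L_lin (-1) 0 0; rewrite mulr0 addr0 mulN1r addNr. Qed.

Lemma functionalD P P' : L (P + P') = L P + L P'.
Proof. by have := L_lin 1 P P'; rewrite !mul1r. Qed.

Lemma functionalZ r P : L (r%:P%:P * P) = r * L P.
Proof. by have := L_lin r P 0; rewrite !addr0 functional0 addr0. Qed.

Lemma functionalN P : L (- P) = - L P.
Proof. by have := functionalZ (-1) P; rewrite !polyCN !mulN1r. Qed.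

Lemma functional_sum I (r : seq I) (Q : pred I) F :
  L (\sum_(i <- r | Q i) F i) = \sum_(i <- r | Q i) L (F i).
Proof. by apply: big_morph; [exact: functionalD | exact: functional0]. Qed.

End BivariateFunctional.

(** Here [%:P] embeds polynomials in x and [^:P] those in z. The one-variable lemma is applied in z
    with H_k(x) fixed, then in x with any polynomial in z fixed. *)
Lemma bihermite_span (R : comNzRingType) (q : R) (F : {poly {poly R}} -> R) :
  poly2_functional F ->
  (forall k n, F ((hermite q k)%:P * (hermite q n)^:P) = 0) ->
  forall P, F P = 0.
Proof.
move=> F_lin F_herm.
have Fkp k p : F ((hermite q k)%:P * p^:P) = 0.
  move: p; apply: (hermite_span (q := q)) => // r p s.
  rewrite rmorphD rmorphM /= map_polyC /= -F_lin.
  by congr F; ring.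
have Fps p s : F (p%:P * s^:P) = 0.
  move: p; apply: (hermite_span (q := q)) => // r p t.
  by rewrite -F_lin; congr F; rewrite polyCD polyCM; ring.
move=> P; rewrite -(coefK P) poly_def functional_sum// big1// => i _.
by rewrite -mul_polyC -['X^i](map_polyXn polyC) Fps.
Qed.

Section HermiteRecurrences.
Context {R : comNzRingType} (q : R).

Lemma hermiteX_rec k : 'X%:P * (hermite q k)%:P =
  (hermite q k.+1)%:P + (qnum q k)%:P%:P * (hermite q k.-1)%:P.
Proof. by rewrite -[LHS]polyCM hermite_rec polyCD polyCM. Qed.

Lemma hermiteZ_rec n : 'X * (hermite q n)^:P =
  (hermite q n.+1)^:P + (qnum q n)%:P%:P * (hermite q n.-1)^:P.
Proof.
rewrite -[X in X * _ = _](map_polyX polyC) -[LHS]rmorphM/= hermite_rec.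
by rewrite rmorphD rmorphM /= map_polyC.
Qed.

End HermiteRecurrences.

(** * Moments E(P(X, Z) Y^j) for j = 0, 1, 2, represented by [L0], [L1], [L2] *)

Section ConditionalMoments.
Context {R : fieldType} (q al be c : R).
Context (L0 L1 L2 : {poly {poly R}} -> R).
Hypotheses (L0_lin : poly2_functional L0) (L1_lin : poly2_functional L1)
  (L2_lin : poly2_functional L2).
Local Notation M := (qcov q c).
Local Notation x := ('X%:P : {poly {poly R}}).
Local Notation z := ('X : {poly {poly R}}).
Local Notation HX k := ((hermite q k)%:P : {poly {poly R}}).
Local Notation HZ n := ((hermite q n)^:P : {poly {poly R}}).
Local Notation "[ n ]" := (qnum q n).

Hypothesis L0E : forall k n, L0 (HX k * HZ n) = M k n.
Hypothesis L1E : forall k n,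
  L1 (HX k * HZ n) = be * [n] * M k n.-1 + al * [k] * M k.-1 n.
Hypothesis L2E : forall k n, L2 (HX k * HZ n) =
  (1 + q) * al * be * [k] * [n] * M k.-1 n.-1 +
  al ^+ 2 * [k] * [k.-1] * M k.-2 n +
  be ^+ 2 * [n] * [n.-1] * M k n.-2 + M k n.

Section Shift.
Context (L : {poly {poly R}} -> R) (L_lin : poly2_functional L).

Lemma functional_shiftx k n : L (x * (HX k * HZ n)) =
  L (HX k.+1 * HZ n) + [k] * L (HX k.-1 * HZ n).
Proof.
by rewrite mulrA hermiteX_rec mulrDl functionalD// -mulrA functionalZ.
Qed.

Lemma functional_shiftz k n : L (z * (HX k * HZ n)) =
  L (HX k * HZ n.+1) + [n] * L (HX k * HZ n.-1).
Proof.
rewrite mulrCA hermiteZ_rec mulrDr functionalD//.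
by rewrite [in X in _ + X]mulrCA functionalZ.
Qed.

End Shift.

Lemma functional_mulx (L : {poly {poly R}} -> R) : poly2_functional L ->
  poly2_functional (fun P => L (x * P)).
Proof. by move=> L_lin r P P'; rewrite mulrDr mulrCA L_lin. Qed.

Lemma functional_mulz (L : {poly {poly R}} -> R) : poly2_functional L ->
  poly2_functional (fun P => L (z * P)).
Proof. by move=> L_lin r P P'; rewrite mulrDr mulrCA L_lin. Qed.

(* With [u] and [v] the [k]-th and [n]-th tensor powers of [f] and [h], [mA],
   [mD] and [mB] are the scalar products of [u] with [a_h a_h v],
   [a_f^* a_f^* v] and [a_f^* a_h v]. Every moment of degree two is a
   combination of these and of [M k n]. *)
Local Notation mA k n := ([n] * [n.-1] * M k n.-2).
Local Notation mD k n := ([k] * [k.-1] * M k.-2 n).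
Local Notation mB k n := ([k] * [n] * M k.-1 n.-1).

Lemma qcov_qnuml k n : [k] * M k n = c * mB k n.
Proof. by case: k => [|k]; rewrite ?qnum0 ?mul0r ?mulr0// qcovSl /=; ring. Qed.

Lemma qcov_qnumr k n : [n] * M k n = c * mB k n.
Proof.
by case: n => [|n]; rewrite ?qnum0 ?mulr0 ?mul0r ?mulr0// qcovSr /=; ring.
Qed.

Lemma qnum_qcovSl k n : [n] * M k.+1 n.-1 = c * mA k n.
Proof. by rewrite qcovSl; ring. Qed.

Lemma qnum_qcovSr k n : [k] * M k.-1 n.+1 = c * mD k n.
Proof. by rewrite qcovSr; ring. Qed.

Lemma moment0_x k n : L0 (x * (HX k * HZ n)) =
  c * [n] * M k n.-1 + [k] * M k.-1 n.
Proof. by rewrite functional_shiftx// !L0E qcovSl. Qed.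

Lemma moment0_z k n : L0 (z * (HX k * HZ n)) =
  c * [k] * M k.-1 n + [n] * M k n.-1.
Proof. by rewrite functional_shiftz// !L0E qcovSr. Qed.

Lemma moment0_xx k n : L0 (x * (x * (HX k * HZ n))) =
  c ^+ 2 * mA k n + mD k n + c * (1 + q) * mB k n + M k n.
Proof.
rewrite (functional_shiftx (functional_mulx L0_lin)) !moment0_x /= qnumSl.
(* The coefficient [k+1] = 1 + q [k] leaves q [k] M(k, n), which becomes q c [mB k n], besides a
   plain M(k, n). The same substitution settles the other moments. *)
rewrite -!mulrA qnum_qcovSl; have := qcov_qnuml k n; move: (M k n) => m.
move=> /(congr1 (fun t => q * t)) e; ring: e.
Qed.

Lemma moment0_zz k n : L0 (z * (z * (HX k * HZ n))) =
  mA k n + c ^+ 2 * mD k n + c * (1 + q) * mB k n + M k n.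
Proof.
rewrite (functional_shiftz (functional_mulz L0_lin)) !moment0_z /= qnumSl.
rewrite -!mulrA qnum_qcovSr; have := qcov_qnumr k n; move: (M k n) => m.
move=> /(congr1 (fun t => q * t)) e; ring: e.
Qed.

Lemma moment0_xz k n : L0 (x * (z * (HX k * HZ n))) =
  c * mA k n + c * mD k n + (1 + q * c ^+ 2) * mB k n + c * M k n.
Proof.
rewrite mulrCA (functional_shiftx (functional_mulz L0_lin)) !moment0_z /=.
rewrite qnumSl.
rewrite qnum_qcovSl; have := qcov_qnuml k n; move: (M k n) => m.
move=> /(congr1 (fun t => c * q * t)) e; ring: e.
Qed.

Lemma moment1_x k n : L1 (x * (HX k * HZ n)) =
  be * c * mA k n + al * mD k n + (be + q * al * c) * mB k n + al * M k n.
Proof.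
rewrite functional_shiftx// !L1E /= qnumSl -!mulrA qnum_qcovSl.
have := qcov_qnuml k n; move: (M k n) => m.
move=> /(congr1 (fun t => al * q * t)) e; ring: e.
Qed.

Lemma moment1_z k n : L1 (z * (HX k * HZ n)) =
  be * mA k n + al * c * mD k n + (al + q * be * c) * mB k n + be * M k n.
Proof.
rewrite functional_shiftz// !L1E /= qnumSl -!mulrA qnum_qcovSr.
have := qcov_qnumr k n; move: (M k n) => m.
move=> /(congr1 (fun t => be * q * t)) e; ring: e.
Qed.

(** Both sides are linear in P, so P = H_i(x) H_j(z) suffices. There the coefficients of [mA] and
    [mD] vanish on both sides, that of [M] is s on both, and comparing those of [mB] determines
    k. *)
Lemma conditional_variance (a b : R) (P : {poly {poly R}}) :
  al = a + b * c -> be = a * c + b -> 1 - q * c ^+ 2 != 0 ->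
  let k := a * b * (1 - q) / (1 - q * c ^+ 2) in
  L2 P - 2 * (a * L1 (x * P) + b * L1 (z * P)) +
    (a ^+ 2 * L0 (x * (x * P)) + b ^+ 2 * L0 (z * (z * P)) +
     2 * a * b * L0 (x * (z * P))) =
  (1 - a ^+ 2 - b ^+ 2 - 2 * a * b * c) * L0 P +
  k * (c * L0 (x * (x * P)) + c * L0 (z * (z * P)) -
       (1 + c ^+ 2) * L0 (x * (z * P)) - c * (1 - c ^+ 2) * L0 P).
Proof.
move=> alE beE nz k; apply/eqP; rewrite -subr_eq0; apply/eqP.
move: P; apply: (bihermite_span (q := q)).
  move=> r P P'; rewrite !mulrDr ![_ * (r%:P%:P * _)]mulrCA.
  rewrite !(L0_lin, L1_lin, L2_lin) -/k; ring.
move=> i j; rewrite moment0_xx moment0_zz moment0_xz moment1_x moment1_z.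
by rewrite L2E L0E /k alE beE; field.
Qed.

End ConditionalMoments.

(** * Orthogonal polynomials *)

Section Orthogonality.
Context {R : comNzRingType} (L : {poly {poly R}} -> R).
Context (L_lin : poly2_functional L) (S : {poly {poly R}} -> Prop).
Context (y : {poly {poly R}}) (u d : nat -> {poly {poly R}}) (lam : nat -> R).
Hypothesis S_closed : forall w n, S w -> S (w * d n).
Hypothesis u_rec : forall n,
  y * u n = u n.+1 + d n * u n + (lam n)%:P%:P * u n.-1.
Hypotheses (lam0 : lam 0%N = 0) (u0 : u 0%N = 1).
Hypothesis L_u : forall w n, S w -> L (w * u n.+1) = 0.

Lemma favard m n w : S w ->
  L (w * u n * u m) = (if n == m then \prod_(i < m) lam i.+1 else 0) * L w.
Proof.
pose h m := \prod_(i < m) lam i.+1.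
have hS k : h k.+1 = lam k.+1 * h k by rewrite /h big_ord_recr mulrC.
rewrite -/(h m).
pose orth k := forall n w, S w ->
  L (w * u n * u k) = (if n == k then h k else 0) * L w.
(* The recurrence reaches two steps back, hence the paired induction. *)
suff /(_ m)[om _] : forall k, orth k /\ orth k.-1 by exact: om.
elim=> [|k [IHk IHk1]].
  suff o0 : orth 0%N by split.
  move=> k v Sv; rewrite u0 mulr1; case: k => [|k] /=.
    by rewrite u0 mulr1 /h big_ord0 mul1r.
  by rewrite L_u// mul0r.
split=> // {}n {}w Sw.
have -> : w * u n * u k.+1 =
    w * u n.+1 * u k + (lam n)%:P%:P * (w * u n.-1 * u k) +
    (w * d n * u n * u k - w * d k * u n * u k) -
    (lam k)%:P%:P * (w * u n * u k.-1).
  have e := u_rec k; have e' := u_rec n.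
  have -> : u k.+1 = y * u k - d k * u k - (lam k)%:P%:P * u k.-1.
    by rewrite e; ring.
  have -> : u n.+1 = y * u n - d n * u n - (lam n)%:P%:P * u n.-1.
    by rewrite e'; ring.
  ring.
rewrite !(functionalD, functionalN)// !functionalZ// !IHk ?IHk1//;
  try exact: S_closed.
have [->|nk] := eqVneq n k.
  rewrite (gtn_eqF (ltnSn k)) (ltn_eqF (ltnSn k)).
  case: k {IHk IHk1 Sw} => [|k] /=; first by rewrite lam0; ring.
  by rewrite (ltn_eqF (ltnSn k)) (gtn_eqF (ltnSn k)) hS; ring.
have [nk1|nk1] := eqVneq n.+1 k.
  rewrite -nk1 /= eqxx ltn_eqF; last by lia.
  rewrite hS ltn_eqF; last by lia.
  ring.
have [->|nk2] := eqVneq n k.+1.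
  rewrite /= eqxx gtn_eqF; last by lia.
  by rewrite hS; ring.
have -> : lam k * ((if n == k.-1 then h k.-1 else 0) * L w) = 0.
  case: k {IHk IHk1 nk2} nk nk1 => [|k]; first by rewrite lam0 mul0r.
  by rewrite eqSS => _ /negbTE ->; ring.
have -> : lam n * ((if n.-1 == k then h k else 0) * L w) = 0.
  case: n {nk nk1} nk2 => [|n]; first by rewrite lam0 mul0r.
  by rewrite eqSS => /negbTE ->; ring.
ring.
Qed.

End Orthogonality.

(** * Al-Salam-Chihara polynomials and the conditional law of Z given X *)

Section QPoly.
Context {R : comNzRingType} (q c : R).
Local Notation x := ('X%:P : {poly {poly R}}).
Local Notation z := ('X : {poly {poly R}}).
Local Notation HZ n := ((hermite q n)^:P : {poly {poly R}}).
Local Notation "[ n ]" := (qnum q n).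

Definition condlam n : R := [n] * (1 - c ^+ 2 * q ^+ n.-1).

(* Al-Salam-Chihara polynomials in [z]: orthogonal for the conditional law
   of [Z] given [X = x]. *)
Fixpoint condherm n : {poly {poly R}} :=
  if n is m.+1 then
    (z - (c * q ^+ m)%:P%:P * x) * condherm m -
    (if m is k.+1 then (condlam m)%:P%:P * condherm k else 0)
  else 1.

Lemma condherm_rec n : z * condherm n =
  condherm n.+1 + (c * q ^+ n)%:P%:P * x * condherm n +
  (condlam n)%:P%:P * condherm n.-1.
Proof.
case: n => [|n]; last by rewrite /=; ring.
by rewrite /= /condlam qnum0 mul0r; ring.
Qed.

Context (L : {poly {poly R}} -> R) (L_lin : poly2_functional L).
Hypothesis L_HZ : forall p k,
  L (p%:P * HZ k) = c ^+ k * L (p * hermite q k)%:P.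

Let ppi n := \prod_(i < n) (1 - c ^+ 2 * q ^+ i).

(** The goal is k = 0, where the falling factorial vanishes for n > 0. General k is carried along
    because the recurrence of [condherm] multiplies by z, which shifts k by one in either
    direction. *)
Lemma functional_condherm n k p : L (p%:P * HZ k * condherm n) =
  qfalling q k n * ppi n * c ^+ (k - n) * L (p * hermite q (k - n))%:P.
Proof.
pose U n := forall k p, L (p%:P * HZ k * condherm n) =
  qfalling q k n * ppi n * c ^+ (k - n) * L (p * hermite q (k - n))%:P.
have ppS m : ppi m.+1 = ppi m * (1 - c ^+ 2 * q ^+ m).
  by rewrite /ppi big_ord_recr.
suff /(_ n)[Un _] : forall m, U m /\ U m.-1 by exact: Un.
elim=> [|m [Um Um1]].
  suff U0 : U 0 by split.
  by move=> j r; rewrite /= mulr1 L_HZ /ppi big_ord0 subn0 !mul1r.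
split=> // {}k {}p.
have -> : p%:P * HZ k * condherm m.+1 = p%:P * HZ k.+1 * condherm m
   + ([k])%:P%:P * (p%:P * HZ k.-1 * condherm m)
   - (c * q ^+ m)%:P%:P * ((p * 'X)%:P * HZ k * condherm m)
   - (condlam m)%:P%:P * (p%:P * HZ k * condherm m.-1).
  have e := condherm_rec m; have e' := hermiteZ_rec q k.
  have -> : HZ k.+1 = z * HZ k - ([k])%:P%:P * HZ k.-1 by rewrite e'; ring.
  have -> : condherm m.+1 = z * condherm m - (c * q ^+ m)%:P%:P * x * condherm m
     - (condlam m)%:P%:P * condherm m.-1 by rewrite e; ring.
  rewrite polyCM; ring.
rewrite !(functionalD, functionalN)// !functionalZ// !Um Um1.
(* For k < m all falling factorials vanish unless m = k + 1; then two terms survive and cancel by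
   the choice of [condlam]. *)
have [km|mk] := ltnP k m.
  rewrite !(qfalling_small _ km) (@qfalling_small _ _ k m.+1); last by lia.
  have [k1m|] := ltnP k.+1 m.
    rewrite (qfalling_small _ k1m) (@qfalling_small _ _ k.-1); last by lia.
    by rewrite (@qfalling_small _ _ k m.-1); [ring | lia].
  move=> mk1; have {km mk1} -> : m = k.+1 by lia.
  rewrite (@qfalling_small _ _ k.-1) /=; last by lia.
  rewrite !subnn !ppS /condlam; ring.
have -> : k = (m + (k - m))%N by lia.
move: (k - m)%N => e {mk}.
have -> : ((m + e).+1 - m = e.+1)%N by lia.
have -> : ((m + e).-1 - m = e.-1)%N by lia.
have -> : (m + e - m = e)%N by lia.
have -> : (m + e - m.+1 = e.-1)%N by lia.
have -> : p * 'X * hermite q e =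
    p * hermite q e.+1 + ([e])%:P * (p * hermite q e.-1).
  by rewrite -mulrA hermite_rec; ring.
rewrite polyCD [(_%:P * _)%:P]polyCM functionalD// functionalZ//.
have fS : qfalling q (m + e) m.+1 = qfalling q (m + e) m * [e].
  by rewrite qfallingSr; congr (_ * qnum _ _); lia.
have ee : c ^+ e * c * [e] = c ^+ 2 * c ^+ e.-1 * [e].
  by case: e {fS} => [|e] /=; rewrite ?qnum0 ?mulr0// exprS; ring.
have -> : [m + e] * (qfalling q (m + e).-1 m * ppi m * c ^+ e.-1 *
      L (p * hermite q e.-1)%:P) =
    qfalling q (m + e) m * [e] * ppi m * c ^+ e.-1 * L (p * hermite q e.-1)%:P.
  by rewrite -fS /=; ring.
rewrite fS ppS exprS.
set a := L (p * hermite q e.+1)%:P; set b := L (p * hermite q e.-1)%:P.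
set t := condlam m * _.
(* Since [m+e+1] = [m] + q^m [e+1], all terms containing [a] cancel. *)
have -> : t = c * c ^+ e *
    (qfalling q (m + e).+1 m - q ^+ m * qfalling q (m + e) m) * ppi m * a.
  rewrite /t; case: m {Um Um1 fS t} => [|m].
    by rewrite /condlam qnum0; ring.
  have -> : (m.+1 + e - m.+1.-1 = e.+1)%N by lia.
  rewrite [qfalling q (m.+1 + e) m.+1]qfallingSr.
  have -> : (m.+1 + e - m = e.+1)%N by lia.
  rewrite [qfalling q (m.+1 + e).+1 m.+1]/= /condlam /= ppS exprS.
  have -> : (m.+1 + e).+1 = (m.+1 + e.+1)%N by lia.
  by rewrite qnumD -/a !exprS; ring.
transitivity (ppi m * qfalling q (m + e) m * b *
    (c ^+ e.-1 * [e] - c ^+ e * c * [e] * q ^+ m)).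
  ring.
by rewrite ee; ring.
Qed.

Lemma functional_condhermS n p : L (p%:P * condherm n.+1) = 0.
Proof.
have := functional_condherm n.+1 0 p.
by rewrite [_^:P]rmorph1 mulr1 => ->; rewrite /= qnum0; ring.
Qed.

End QPoly.

(** * Spread of the joint law *)

(* A flat window of four orthonormal vectors: in the limit it gives the Jacobi
   matrix with constant weight r the value [3 / 2 * r], whereas three vectors
   would only give [4 / 3 * r], which is less than [sqrt 2 * r]. *)
Definition window {R : rcfType} (u : nat -> {poly {poly R}}) (lam : nat -> R)
    (N : nat) (s : R) : {poly {poly R}} :=
  let v n := (Num.sqrt (\prod_(i < n) lam i.+1))^-1%:P%:P * u n in
  v N + s%:P%:P * v N.+1 + v N.+2 + s%:P%:P * v N.+3.

Section Window.
Context {R : rcfType} (L : {poly {poly R}} -> R) (L_lin : poly2_functional L).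
Context (y : {poly {poly R}}) (u d : nat -> {poly {poly R}}) (lam : nat -> R).
Context (w : {poly {poly R}}).
Let h n := \prod_(i < n) lam i.+1.
Hypothesis lam_gt0 : forall n, 0 < lam n.+1.
Hypothesis u_rec : forall n,
  y * u n = u n.+1 + d n * u n + (lam n)%:P%:P * u n.-1.
Hypothesis orth : forall n m,
  L (w * u n * u m) = (if n == m then h m else 0) * L w.
Hypothesis orthd : forall k n m,
  L (w * d k * u n * u m) = (if n == m then h m else 0) * L (w * d k).

Let v n := (Num.sqrt (h n))^-1%:P%:P * u n.

Let h_gt0 n : 0 < h n. Proof. by apply: prodr_gt0 => i _. Qed.

Let hS n : h n.+1 = lam n.+1 * h n.
Proof. by rewrite /h big_ord_recr mulrC. Qed.

Let L_vv n m : L (w * v n * v m) = if n == m then L w else 0.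
Proof.
have -> : w * v n * v m = (Num.sqrt (h n))^-1%:P%:P *
  ((Num.sqrt (h m))^-1%:P%:P * (w * u n * u m)) by rewrite /v; ring.
rewrite !functionalZ// orth; case: eqP => [->|_]; last by rewrite mul0r !mulr0.
rewrite !mulrA -[X in _ * X * _](@sqr_sqrtr _ (h m)) ?ltW//.
by field; rewrite sqrtr_eq0 -ltNge.
Qed.

Let L_yvE n m : L (w * y * v n * v m) =
  (Num.sqrt (h n))^-1 * (Num.sqrt (h m))^-1 *
  ((if n.+1 == m then h m else 0) * L w +
   (if n == m then h m else 0) * L (w * d n) +
   lam n * (if n.-1 == m then h m else 0) * L w).
Proof.
have -> : w * y * v n * v m = (Num.sqrt (h n))^-1%:P%:P *
  ((Num.sqrt (h m))^-1%:P%:P * (w * u n.+1 * u m + w * d n * u n * u m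
    + (lam n)%:P%:P * (w * u n.-1 * u m))).
  have e := u_rec n.
  have -> : u n.+1 = y * u n - d n * u n - (lam n)%:P%:P * u n.-1.
    by rewrite e; ring.
  rewrite /v; ring.
by rewrite !functionalZ// !functionalD// functionalZ// !orth orthd; ring.
Qed.

(** At n = 0 the convention 0.-1 = 0 turns [lam 0] into a diagonal entry; windows start at N > 0 to
    avoid it. *)
Let L_yvv n : L (w * y * v n * v n) =
  L (w * d n) + (if n is 0%N then lam 0%N * L w else 0).
Proof.
have e : (Num.sqrt (h n))^-1 * (Num.sqrt (h n))^-1 * h n = 1.
  rewrite -[X in _ * X = _](@sqr_sqrtr _ (h n)) ?ltW//.
  by field; rewrite sqrtr_eq0 -ltNge.
rewrite L_yvE eqxx (gtn_eqF (ltnSn n)).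
case: n e => [|n] /= e.
  by ring: e.
rewrite (ltn_eqF (ltnSn n)); ring: e.
Qed.

Let L_yvvS n : L (w * y * v n * v n.+1) = Num.sqrt (lam n.+1) * L w.
Proof.
rewrite L_yvE eqxx (ltn_eqF (ltnSn n)) ltn_eqF; last by lia.
rewrite -[X in _ * (X * _ + _ + _)](@sqr_sqrtr _ (h n.+1)) ?ltW//.
rewrite hS sqrtrM ?ltW//; field.
by rewrite !sqrtr_eq0 -!ltNge lam_gt0 h_gt0.
Qed.

Let L_yvvlt n m : (n.+1 < m)%N -> L (w * y * v n * v m) = 0.
Proof.
by move=> nm; rewrite L_yvE (ltn_eqF nm) ltn_eqF ?ltn_eqF; [ring|lia|lia].
Qed.

(** On the orthonormal v_n, multiplication by y is a Jacobi matrix with couplings sqrt(lam_{n+1})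
    and diagonal d_n; the three couplings inside the window all get the sign s. Both identities are
    algebraic, so they also apply to a weight w of changing sign. *)
Lemma windowP N s : (0 < N)%N -> s * s = 1 ->
  L (w * window u lam N s ^+ 2) = 4 * L w /\
  L (w * (y * window u lam N s ^+ 2)) =
    2 * s * (Num.sqrt (lam N.+1) + Num.sqrt (lam N.+2) + Num.sqrt (lam N.+3))
      * L w + (L (w * d N) + L (w * d N.+1) + L (w * d N.+2) + L (w * d N.+3)).
Proof.
case: N => // N _ ss; set M := N.+1.
rewrite [window _ _ _ _]/(v M + s%:P%:P * v M.+1 + v M.+2 + s%:P%:P * v M.+3).
have ssP : s%:P%:P * s%:P%:P = 1 :> {poly {poly R}} by rewrite -!polyCM ss.
have E t : t * (v M + s%:P%:P * v M.+1 + v M.+2 + s%:P%:P * v M.+3) ^+ 2 =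
    t * v M * v M + t * v M.+1 * v M.+1 +
    t * v M.+2 * v M.+2 + t * v M.+3 * v M.+3
  + (2 * s)%:P%:P * (t * v M * v M.+1 + t * v M.+1 * v M.+2 +
      t * v M.+2 * v M.+3 + t * v M * v M.+3)
  + 2%:P%:P * (t * v M * v M.+2 + t * v M.+1 * v M.+3).
  move: (v M) (v M.+1) (v M.+2) (v M.+3) => v0 v1 v2 v3.
  have -> : (2 * s)%:P%:P = 2 * s%:P%:P :> {poly {poly R}}.
    by rewrite !polyCM !polyC_natr.
  have -> : 2%:P%:P = 2 :> {poly {poly R}} by rewrite !polyC_natr.
  move: (s%:P%:P) ssP => S SS; ring: SS.
rewrite [w * (y * _)]mulrA !E !functionalD// !functionalZ// !functionalD//.
have n1 k : (k == k.+1) = false by rewrite ltn_eqF.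
have n2 k : (k == k.+2) = false by rewrite ltn_eqF; lia.
have n3 k : (k == k.+3) = false by rewrite ltn_eqF; lia.
rewrite !L_vv !eqxx !n1 !n2 !n3 !L_yvv !L_yvvS !L_yvvlt//.
by split; rewrite ?/M; ring.
Qed.

End Window.

(** The constants balance exactly: the couplings give at least 36 rho^2 = 34 T, the four diagonal
    terms cost at most 2 T, and 32 T remains, where 4 * 4 = 16 is the squared norm of the test
    function. *)
Lemma window_estimate (R : realFieldType) (T rho l t0 t1 t2 q0 q1 q2 q3 : R) :
  0 <= rho -> rho * rho = 17 / 18 * T -> 6 * rho <= l ->
  rho <= t0 -> rho <= t1 -> rho <= t2 ->
  q0 <= T / 2 -> q1 <= T / 2 -> q2 <= T / 2 -> q3 <= T / 2 ->
  2 * T * (4 * 4) <= - (2 * -1 * (t0 + t1 + t2) * l + (q0 + q1 + q2 + q3)).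
Proof.
move=> rho0 rho2 hl h0 h1 h2 *.
have : 18 * (rho * rho) <= (t0 + t1 + t2) * l.
  have -> : 18 * (rho * rho) = (3 * rho) * (6 * rho) by ring.
  by apply: ler_pM => //; lra.
lra.
Qed.

Section Spread.
Context {R : realType} (q c : R).
Hypotheses (q_gtN1 : -1 < q) (q_lt1 : q < 1) (c_ge0 : 0 <= c) (c_lt1 : c < 1).
Context (L : {poly {poly R}} -> R) (L_lin : poly2_functional L).
Hypothesis LE : forall k n,
  L ((hermite q k)%:P * (hermite q n)^:P) = qcov q c k n.
Local Notation x := ('X%:P : {poly {poly R}}).
Local Notation z := ('X : {poly {poly R}}).
Local Notation "[ n ]" := (qnum q n).

Lemma normq_lt1 : `|q| < 1.
Proof. by rewrite ltr_norml q_gtN1 q_lt1. Qed.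

Lemma exprn_norm_small (e : R) : 0 < e ->
  exists N, forall n, (N <= n)%N -> `|q| ^+ n <= e.
Proof.
move=> e0; have q1 : `|(`|q|)| < 1 by rewrite normr_id normq_lt1.
have /cvgr0_norm_le/(_ e e0) := cvg_expr q1.
case=> N _ HN; exists N => n /HN /=.
by rewrite ger0_norm ?exprn_ge0.
Qed.

Lemma exprn_norm_le1 n : `|q| ^+ n <= 1.
Proof. by apply: exprn_ile1; rewrite ?normr_ge0 ?ltW ?normq_lt1. Qed.

Lemma subr1_sqrM_ge n e : 0 <= e -> `|q| ^+ n <= e ->
  1 - e <= 1 - c ^+ 2 * q ^+ n.
Proof.
move=> e0 qe; have := ler_norm (q ^+ n); rewrite normrX => qn.
have c2 : 0 <= c ^+ 2 <= 1 by rewrite sqr_ge0 expr_le1// ltW.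
nra.
Qed.


Lemma qnum_gt0 n : 0 < [n.+1].
Proof.
have qn : q ^+ n.+1 < 1.
  apply: le_lt_trans (ler_norm _) _.
  by rewrite normrX exprn_ilt1 ?normr_ge0 ?normq_lt1.
by rewrite -(pmulr_rgt0 _ (x := 1 - q)) ?subr_gt0// mulr_subq1_qnum subr_gt0.
Qed.

Lemma condlam_gt0 n : 0 < condlam q c n.+1.
Proof.
rewrite mulr_gt0 ?qnum_gt0//= subr_gt0.
apply: le_lt_trans (_ : c ^+ 2 < 1); last by rewrite exprn_ilt1.
rewrite ler_piMr ?sqr_ge0//; apply: le_trans (ler_norm _) _.
by rewrite normrX exprn_norm_le1.
Qed.

Definition constant_poly (w : {poly {poly R}}) := exists r : R, w = r%:P%:P.

Lemma functional_hermite2 n m w : constant_poly w ->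
  L (w * (hermite q n)%:P * (hermite q m)%:P) =
  (if n == m then qfact q m else 0) * L w.
Proof.
move=> Sw; apply: (@favard _ L L_lin constant_poly x (fun k => (hermite q k)%:P)
  (fun=> 0) (qnum q)) => //.
- by move=> t _ _; rewrite mulr0; exists 0; rewrite !polyC0.
- by move=> k; rewrite mul0r addr0 hermiteX_rec.
- exact: qnum0.
move=> _ k [r ->]; rewrite functionalZ//.
by have := LE k.+1 0; rewrite [_^:P]rmorph1 mulr1 => ->; rewrite mulr0.
Qed.

Lemma functional1 : L 1 = 1.
Proof.
have := LE 0 0; rewrite [_^:P]rmorph1 mulr1 => ->.
by rewrite /qcov /= expr0 mul1r /qfact big_ord0.
Qed.

(** This is E(H_k(Z) | X) = c^k H_k(X). Tested against H_n(X), only n = k contributes, by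
    orthogonality. *)
Lemma functional_HZ p k :
  L (p%:P * (hermite q k)^:P) = c ^+ k * L (p * hermite q k)%:P.
Proof.
apply/eqP; rewrite -subr_eq0; apply/eqP.
move: p; apply: (hermite_span (q := q)).
  move=> r p s; rewrite mulrDl -mulrA !polyCD !polyCM mulrDl -mulrA !L_lin.
  by rewrite -polyCM; ring.
move=> n; rewrite LE polyCM -[(hermite q n)%:P]mul1r functional_hermite2.
  by rewrite functional1 /qcov; case: eqP => _; ring.
by exists 1.
Qed.

(** A window of q-Hermite polynomials with s = 1: the couplings sqrt([n]) tend to (1 - q)^(-1/2),
    and three of them, doubled, give the factor 6. *)
Lemma spread1 (r : R) : 0 <= r -> r < 1 -> exists p : {poly R},
  L (p ^+ 2)%:P = 4 /\ 6 * Num.sqrt (r / (1 - q)) <= L (x * (p ^+ 2)%:P).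
Proof.
move=> r0 r1.
(* From |q|^n <= 1 - r follows (1 - q) [n] = 1 - q^n >= r. *)
have [|K HK] := @exprn_norm_small (1 - r); first by rewrite subr_gt0.
have S1 : constant_poly 1 by exists 1.
have S0 : constant_poly 0 by exists 0; rewrite !polyC0.
have rec n : x * (hermite q n)%:P = (hermite q n.+1)%:P +
    0 * (hermite q n)%:P + (qnum q n)%:P%:P * (hermite q n.-1)%:P.
  by rewrite mul0r addr0 hermiteX_rec.
have orthd (k n m : nat) : L (1 * 0 * (hermite q n)%:P * (hermite q m)%:P) =
    (if n == m then qfact q m else 0) * L (1 * 0).
  by apply: functional_hermite2; rewrite mulr0.
have := windowP L_lin (d := fun=> 0) qnum_gt0 rec
  (fun n m => functional_hermite2 n m S1) orthd (ltn0Sn K) (mulr1 1).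
set psi := window _ _ _ _.
have [p ->] : exists p, psi = p%:P.
  by rewrite /psi /window -!polyCM -!polyCD; eexists.
rewrite !mul1r (functional0 L_lin) functional1 !addr0 !mulr1 => -[e1 e2].
exists p; rewrite rmorphXn /= e1; split=> //; rewrite e2.
have sq n : (K <= n)%N -> Num.sqrt (r / (1 - q)) <= Num.sqrt (qnum q n).
  move=> /HK qn; apply: ler_wsqrtr; rewrite ler_pdivrMr ?subr_gt0// mulrC.
  rewrite mulr_subq1_qnum; have := ler_norm (q ^+ n); rewrite normrX; lra.
have k2 := leqW (leqnSn K); have k3 := leqW k2.
have s2 := sq _ k2; have s3 := sq _ k3; have s4 := sq _ (leqW k3); lra.
Qed.

(** A window in x times a window in z conditionally on X, the latter with s = -1 so that z is pushed
    against x. Each contributes a factor close to 3/2, so in the limit 9/4 would replace the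
    constant 2, which leaves room for the errors. *)
Lemma spread : exists phi, 0 < L (phi ^+ 2) /\
  2 / (1 - q) * L (phi ^+ 2) <= - L (x * (z * phi ^+ 2)).
Proof.
set T := (1 - q)^-1.
have T0 : 0 < T by rewrite invr_gt0 subr_gt0.
have [||p [p1 px]] := @spread1 (17 / 18); [lra|lra|].
have e36 : 0 <= 1 / 36 :> R by lra.
have e35 : 0 <= 1 - 1 / 36 :> R by lra.
(* For large n both factors of (1 - q) [condlam] (n+1) = (1 - q^(n+1)) (1 - c^2 q^n) are at least
   35/36, hence the product is at least 17/18. *)
have e18 : 17 / 18 <= (1 - 1 / 36) * (1 - 1 / 36) :> R by lra.
have [K HK] := @exprn_norm_small (1 / 36) ltac:(lra).
set C := L (x * x * (p ^+ 2)%:P).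
(* This makes each diagonal term c q^k C at most T / 2; the [+ 1] guards against C = 0. *)
have [|N HN] := @exprn_norm_small (T / (2 * (`|C| + 1))).
  by rewrite divr_gt0// mulr_gt0// ltr_pwDr.
pose N' := (K + N).+1.
pose S (w : {poly {poly R}}) := exists p : {poly R}, w = p%:P.
have S_closed k w : S w -> S (w * ((c * q ^+ k)%:P%:P * x)).
  by case=> p' ->; rewrite -!polyCM; eexists.
have orth n m w : S w -> L (w * condherm q c n * condherm q c m) =
    (if n == m then \prod_(i < m) condlam q c i.+1 else 0) * L w.
  move=> Sw; apply: (@favard _ L L_lin S z (condherm q c)
    (fun n => (c * q ^+ n)%:P%:P * x) (condlam q c)) => //.
  - by move=> w' k; apply: S_closed.
  - exact: condherm_rec.
  - by rewrite /condlam qnum0 mul0r.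
  - by move=> _ k [p' ->]; apply: functional_condhermS L_lin functional_HZ _ _.
pose psi := window (condherm q c) (condlam q c) N' (-1).
have sN1 : (-1) * (-1) = 1 :> R by rewrite mulrNN mulr1.
have win w : S w -> _ := fun Sw => windowP L_lin condlam_gt0
  (condherm_rec q c) (fun n m => orth n m w Sw)
  (fun k n m => orth n m _ (S_closed k w Sw)) (ltn0Sn _ : 0 < N')%N sN1.
pose P2 := (p ^+ 2)%:P.
have [] := win P2 (ex_intro _ _ erefl); rewrite -/psi => e1 _.
(* The factor x is absorbed into the weight, so that the window in z evaluates the moment of x z. *)
have [|_] := win (P2 * x); first by rewrite -polyCM; eexists.
rewrite -/psi => e2.
exists (p%:P * psi).
have -> : (p%:P * psi) ^+ 2 = P2 * psi ^+ 2 by rewrite exprMn -rmorphXn.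
have -> : x * (z * (P2 * psi ^+ 2)) = P2 * x * (z * psi ^+ 2) by ring.
rewrite e1 e2 p1; split; first by lra.
have eC k : P2 * x * ((c * q ^+ k)%:P%:P * x) =
    (c * q ^+ k)%:P%:P * (x * x * P2).
  by ring.
rewrite !eC !functionalZ// -/C.
set rho := Num.sqrt (17 / 18 / (1 - q)) in px.
have L4 : 6 * rho <= L (P2 * x) by rewrite [P2 * x]mulrC.
have rho0 : 0 <= rho := sqrtr_ge0 _.
have rho2 : rho * rho = 17 / 18 * T.
  by rewrite -expr2 sqr_sqrtr// divr_ge0 ?subr_ge0 ?ltW//; lra.
have sq n : (K <= n)%N -> rho <= Num.sqrt (condlam q c n.+1).
  move=> Kn; apply: ler_wsqrtr; rewrite ler_pdivrMr ?subr_gt0//.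
  rewrite /condlam /= mulrAC [X in _ <= X * _]mulrC mulr_subq1_qnum.
  have cq := subr1_sqrM_ge e36 (HK _ Kn).
  have qn : 1 - 1 / 36 <= 1 - q ^+ n.+1.
    rewrite lerD2l lerN2; apply: le_trans (ler_norm _) _.
    by rewrite normrX HK// leqW.
  exact: le_trans e18 (ler_pM e35 e35 qn cq).
have qC k : (N <= k)%N -> c * q ^+ k * C <= T / 2.
  move=> Nk; apply: le_trans (ler_norm _) _; rewrite !normrM normrX.
  have {}/HN := Nk; rewrite ler_pdivlMr; last by rewrite mulr_gt0// ltr_pwDr.
  rewrite (ger0_norm c_ge0) => h; rewrite ler_pdivlMr//.
  apply: le_trans h; rewrite mulrCA [_ * 2]mulrC ler_pM2l// -mulrA mulrDr.
  apply: le_trans (_ : `|q| ^+ k * `|C| <= _).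
    by rewrite ler_piMl ?mulr_ge0 ?exprn_ge0// ltW.
  by rewrite lerDl mulr1 exprn_ge0.
have NN : (N <= N')%N by rewrite /N' leqW// leq_addl.
have KN : (K <= N')%N by rewrite /N' leqW// leq_addr.
have q0 := qC _ NN; have q1 := qC _ (leqW NN).
have q2 := qC _ (leqW (leqW NN)); have q3 := qC _ (leqW (leqW (leqW NN))).
have s0 := sq _ KN; have s1 := sq _ (leqW KN); have s2 := sq _ (leqW (leqW KN)).
exact: window_estimate rho0 rho2 L4 s0 s1 s2 q0 q1 q2 q3.
Qed.

End Spread.

(** * Bell's inequality for moment functionals *)

(** N, A, B, C are the moments of phi^2 times 1, x^2, z^2, x z. The claim is s + 2 a b (1 + c) >= 0,
    since this quantity equals 1 - (a - b)^2. It is immediate if a b >= 0; otherwise it follows from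
    [key] and a lower bound for [W]. *)
Lemma bell_coefficients (R : realFieldType) (q c a b s N A B C : R) :
  -1 < q -> q < 1 -> 0 <= c -> c < 1 -> 0 < N ->
  s = 1 - a ^+ 2 - b ^+ 2 - 2 * a * b * c -> 0 <= s ->
  0 <= A + 2 * C + B -> 2 / (1 - q) * N <= - C ->
  0 <= s * N + a * b * (1 - q) / (1 - q * c ^+ 2) *
    (c * A + c * B - (1 + c ^+ 2) * C - c * (1 - c ^+ 2) * N) ->
  (a - b) ^+ 2 <= 1.
Proof.
move=> q_gt q_lt c_ge c_lt N_gt sE s_ge AB CN key.
have [ab|ab] := leP 0 (a * b).
  have : 0 <= a * b * (1 + c) by rewrite mulr_ge0 ?addr_ge0.
  by move: s_ge; rewrite sE; lra.
have d_gt : 0 < 1 - q * c ^+ 2.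
  have : c ^+ 2 < 1 by rewrite exprn_ilt1.
  have := sqr_ge0 c; move: (c ^+ 2) => t t0 t1; nra.
set W := (X in _ + _ * X) in key.
(* W = c (A + 2 C + B) - (1 + c)^2 C - c (1 - c^2) N, where the first term is nonnegative and - C is
   large. The surplus over the claim is the quantity in [h4]. *)
have W_ge : 2 * (1 + c) * (1 - q * c ^+ 2) * N <= (1 - q) * W.
  have h1 : 2 * N <= (1 - q) * - C.
    by move: CN; rewrite mulrAC ler_pdivrMr ?subr_gt0// [- C * _]mulrC.
  have h2 : 0 <= c * (1 - q) * (A + 2 * C + B).
    have q1 : 0 <= 1 - q by rewrite subr_ge0 ltW.
    by rewrite !mulr_ge0.
  have h3 : (1 + c) ^+ 2 * (2 * N) <= (1 + c) ^+ 2 * ((1 - q) * - C).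
    by rewrite ler_wpM2l// sqr_ge0.
  have h4 : 0 <= c * (1 + q) * (1 + c) ^+ 2 * N.
    have q1 : 0 <= 1 + q by lra.
    by rewrite mulr_ge0 ?(ltW N_gt)// mulr_ge0 ?sqr_ge0// mulr_ge0.
  have -> : (1 - q) * W = c * (1 - q) * (A + 2 * C + B) +
      (1 + c) ^+ 2 * ((1 - q) * - C) - c * (1 - c ^+ 2) * (1 - q) * N.
    by rewrite /W; ring.
  have -> : 2 * (1 + c) * (1 - q * c ^+ 2) * N = (1 + c) ^+ 2 * (2 * N) -
     c * (1 - c ^+ 2) * (1 - q) * N - c * (1 + q) * (1 + c) ^+ 2 * N by ring.
  lra.
have le1 : 2 * (1 + c) * N <= (1 - q) * W / (1 - q * c ^+ 2).
  by rewrite ler_pdivlMr// mulrAC.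
have : 0 <= (s + a * b * (2 * (1 + c))) * N.
  apply: le_trans key _; rewrite mulrDl lerD2l.
  rewrite -[in leRHS]mulrA.
  have -> : a * b * (1 - q) / (1 - q * c ^+ 2) * W =
    a * b * ((1 - q) * W / (1 - q * c ^+ 2)) by field; rewrite gt_eqF.
  by rewrite ler_nM2l.
by rewrite pmulr_lge0// sE; lra.
Qed.

Section BellFunctional.
Context {R : realType} (q al be c : R).
Hypotheses (q_gtN1 : -1 < q) (q_lt1 : q < 1) (c_ge0 : 0 <= c) (c_lt1 : c < 1).
Context (L0 L1 L2 : {poly {poly R}} -> R).
Hypotheses (L0_lin : poly2_functional L0) (L1_lin : poly2_functional L1)
  (L2_lin : poly2_functional L2).
Local Notation M := (qcov q c).
Local Notation x := ('X%:P : {poly {poly R}}).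
Local Notation z := ('X : {poly {poly R}}).
Local Notation HX k := ((hermite q k)%:P : {poly {poly R}}).
Local Notation HZ n := ((hermite q n)^:P : {poly {poly R}}).
Local Notation "[ n ]" := (qnum q n).

Hypothesis L0E : forall k n, L0 (HX k * HZ n) = M k n.
Hypothesis L1E : forall k n,
  L1 (HX k * HZ n) = be * [n] * M k n.-1 + al * [k] * M k.-1 n.
Hypothesis L2E : forall k n, L2 (HX k * HZ n) =
  (1 + q) * al * be * [k] * [n] * M k.-1 n.-1 +
  al ^+ 2 * [k] * [k.-1] * M k.-2 n +
  be ^+ 2 * [n] * [n.-1] * M k n.-2 + M k n.
Hypothesis residual_ge0 : forall a b phi,
  0 <= L2 (phi ^+ 2) - 2 * (a * L1 (x * phi ^+ 2) + b * L1 (z * phi ^+ 2)) +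
    (a ^+ 2 * L0 (x * (x * phi ^+ 2)) + b ^+ 2 * L0 (z * (z * phi ^+ 2)) +
     2 * a * b * L0 (x * (z * phi ^+ 2))).
Hypothesis sum_ge0 : forall phi,
  0 <= L0 (x * (x * phi ^+ 2)) + 2 * L0 (x * (z * phi ^+ 2)) +
    L0 (z * (z * phi ^+ 2)).

Lemma bell_functional : `|al - be| <= 1 - c.
Proof.
have c2 : 1 - c ^+ 2 != 0 by rewrite subr_eq0 eq_sym lt_eqF// exprn_ilt1.
have d0 : 1 - q * c ^+ 2 != 0.
  rewrite gt_eqF// subr_gt0; apply: le_lt_trans (ler_norm _) _.
  rewrite normrM normrX (ger0_norm c_ge0).
  apply: le_lt_trans (_ : `|q| < 1); last by rewrite ltr_norml q_gtN1.
  by rewrite ler_piMr// exprn_ile1// ltW.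
(* Regression coefficients of Y on X and Z: the solution of al = a + b c, be = a c + b. They satisfy
   al - be = (a - b) (1 - c), which reduces the claim to |a - b| <= 1. *)
pose a := (al - be * c) / (1 - c ^+ 2); pose b := (be - al * c) / (1 - c ^+ 2).
have alE : al = a + b * c by rewrite /a /b; field.
have beE : be = a * c + b by rewrite /a /b; field.
have cv P := conditional_variance L0_lin L1_lin L2_lin L0E L1E L2E P alE beE d0.
have H00 : HX 0 * HZ 0 = 1 by rewrite [_^:P]rmorph1 mulr1.
set s := 1 - a ^+ 2 - b ^+ 2 - 2 * a * b * c in cv.
have M00 : M 0 0 = 1 by rewrite /qcov eqxx expr0 /qfact big_ord0 mulr1.
(* The conditional variance is tested against 1, where the W term has mean zero. *)
have s_ge0 : 0 <= s.
  have := residual_ge0 a b 1; rewrite /= cv expr1n -H00.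
  rewrite (moment0_xx L0_lin L0E) (moment0_zz L0_lin L0E).
  rewrite (moment0_xz L0_lin L0E) L0E M00 qnum0 !(mul0r, mulr0, add0r, mulr1).
  by congr (0 <= _); ring.
have [phi [N_gt CN]] := spread q_gtN1 q_lt1 c_ge0 c_lt1 L0_lin L0E.
have := residual_ge0 a b phi; rewrite /= cv => key.
have := bell_coefficients q_gtN1 q_lt1 c_ge0 c_lt1 N_gt erefl s_ge0
  (sum_ge0 phi) CN key.
rewrite -[_ ^+ 2]ger0_norm ?sqr_ge0// normrX expr_le1// => ab.
have -> : al - be = (a - b) * (1 - c) by rewrite alE beE; ring.
have c1 : 0 <= 1 - c by rewrite subr_ge0 ltW.
by rewrite normrM (ger0_norm c1) ler_piMl.
Qed.

End BellFunctional.

(** * Moments in the q-Fock space *)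

Local Open Scope complex_scope.

Section RealBraket.
Context {R : realType} (V : realHilbertType R).
Implicit Types x y : V.

Lemma real_braketC x y : braket x y = braket y x.
Proof. by rewrite /braket hermC expr0 mul1r. Qed.

Lemma real_braket0l x : braket 0 x = 0.
Proof. exact: linear0r. Qed.

Lemma real_braket0r x : braket x 0 = 0.
Proof. exact: linear0l. Qed.

Lemma real_braket_unit x : `|x| = 1 -> braket x x = 1.
Proof. by rewrite /braket -hilbert_normE => ->; rewrite expr1n. Qed.

End RealBraket.

Section ComplexBraket.
Context {R : realType} (V : complexHilbertType R).
Implicit Types x y : V.

Lemma braketDr x y y' : braket x (y + y') = braket x y + braket x y'.
Proof. exact: linearDl. Qed.

Lemma braketZr c x y : braket x (c *: y) = c * braket x y.
Proof. exact: linearZl_LR. Qed.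

Lemma braket0r x : braket x 0 = 0.
Proof. exact: linear0l. Qed.

Lemma braketC x y : braket x y = Num.conj (braket y x).
Proof. by rewrite /braket hermC expr0 mul1r. Qed.

Lemma braketDl x x' y : braket (x + x') y = braket x y + braket x' y.
Proof. exact: linearDr. Qed.

Lemma braketZl c x y : braket (c *: x) y = Num.conj c * braket x y.
Proof. exact: linearZr_LR. Qed.

Lemma braketZl_real (r : R) x y : braket (r%:C *: x) y = r%:C * braket x y.
Proof. by rewrite braketZl; congr (_ * _); exact: conjc_real. Qed.

Lemma braket_real x y (r : R) : braket x y = r%:C -> braket y x = r%:C.
Proof. by move=> e; rewrite braketC e; exact: conjc_real. Qed.

Lemma braket_suml I (s : seq I) (P : pred I) (F : I -> V) y :
  braket (\sum_(i <- s | P i) F i) y = \sum_(i <- s | P i) braket (F i) y.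
Proof. exact: linear_sumr. Qed.

Lemma braket_sumr I (s : seq I) (P : pred I) (F : I -> V) x :
  braket x (\sum_(i <- s | P i) F i) = \sum_(i <- s | P i) braket x (F i).
Proof.
by apply: big_morph; [exact: braketDr | exact: braket0r].
Qed.

End ComplexBraket.

Section OpHorner.
Context {R : realType} (V : lmodType R[i]) (T : {linear V -> V}).
Implicit Types (p s : {poly R}) (v : V).

Lemma op_horner_widen n p v : (size p <= n)%N ->
  op_horner p T v = \sum_(i < n) (p`_i)%:C *: iter i T v.
Proof.
move=> pn; rewrite /op_horner.
rewrite (big_ord_widen n (fun i => (p`_i)%:C *: iter i T v))//.
rewrite big_mkcond; apply: eq_bigr => i _; case: ltnP => // /(nth_default 0) ->.
by rewrite scale0r.
Qed.

Lemma op_horner_lin (r : R) p s v :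
  op_horner (r%:P * p + s) T v = r%:C *: op_horner p T v + op_horner s T v.
Proof.
pose n := maxn (size p) (size s).
rewrite (@op_horner_widen n p) ?leq_maxl// (@op_horner_widen n s) ?leq_maxr//.
rewrite (@op_horner_widen n); last first.
  rewrite (leq_trans (size_polyD _ _))// geq_max leq_maxr andbT.
  by rewrite mul_polyC (leq_trans (size_scale_leq _ _))// leq_maxl.
rewrite scaler_sumr -big_split; apply: eq_bigr => i _ /=.
by rewrite coefD coefCM rmorphD rmorphM scalerDl scalerA.
Qed.

Lemma op_hornerX p v : op_horner ('X * p) T v = T (op_horner p T v).
Proof.
rewrite (@op_horner_widen (size p).+1); last first.
  by rewrite (leq_trans (size_polyMleq _ _))// size_polyX.
rewrite big_ord_recl coefXM scale0r add0r /op_horner linear_sum.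
by apply: eq_bigr => i _; rewrite coefXM linearZ.
Qed.

Lemma op_horner1 v : op_horner 1 T v = v.
Proof. by rewrite /op_horner size_poly1 big_ord1 coefC scale1r. Qed.

End OpHorner.

Section FockMoments.
Context {R : realType} (q : R) (H : realHilbertType R) (G : qFock q H).
Context (a : fock_operators G).
Local Notation Phi := (vacuum G).
Local Notation tpow n f := (fock_tensor G (nseq n (real_vector f))).
Local Notation "[ n ]" := (qnum q n).

Lemma complexification_braket_real (f g : H) :
  complexification_braket (real_vector f) (real_vector g) = (braket f g)%:C.
Proof.
rewrite /complexification_braket /= !real_braket0l !real_braket0r.
by rewrite addr0 subrr.
Qed.

Fact qgaussian_linear f : linear (qgaussian a f).
Proof. by move=> c x y; rewrite /qgaussian !linearP scalerDr addrACA. Qed.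

HB.instance Definition _ f :=
  GRing.isLinear.Build R[i] G G *:%R (qgaussian a f) (qgaussian_linear f).

Lemma annihilation_adjoint f (x y : G) :
  braket x (creation a f y) = braket (annihilation a f x) y.
Proof. by rewrite braketC creation_adjoint -braketC. Qed.

Lemma qgaussian_selfadjoint f (x y : G) :
  braket (qgaussian a f x) y = braket x (qgaussian a f y).
Proof.
rewrite /qgaussian braketDl braketDr annihilation_adjoint creation_adjoint.
by rewrite addrC.
Qed.

Lemma op_horner_selfadjoint f p (x y : G) :
  braket (op_horner p (qgaussian a f) x) y =
  braket x (op_horner p (qgaussian a f) y).
Proof.
rewrite /op_horner braket_suml braket_sumr; apply: eq_bigr => i _.
rewrite braketZl_real braketZr; congr (_ * _).
elim: {i}(val i) x y => //= n IHn x y.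
by rewrite qgaussian_selfadjoint IHn -iterSr.
Qed.

Lemma annihilation_pow g f n :
  annihilation a g (tpow n f) = ([n] * braket g f)%:C *: tpow n.-1 f.
Proof.
rewrite annihilationE size_nseq /qnum mulr_suml rmorph_sum/= scaler_suml.
apply: eq_bigr => i _; rewrite nth_nseq ltn_ord complexification_braket_real.
rewrite rmorphM; congr (_ *: fock_tensor G _).
rewrite take_nseq ?(ltnW (ltn_ord i))// drop_nseq -nseqD.
by congr (nseq _ _); have := ltn_ord i; lia.
Qed.

(** Deleting the leading g is the term j = 0; it shifts all other positions by one, hence the extra
    factor q. *)
Lemma annihilation_cons_pow g f n :
  annihilation a g (fock_tensor G (real_vector g :: nseq n (real_vector f))) =
  (braket g g)%:C *: tpow n f + (q * [n] * braket g f)%:C *: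
    fock_tensor G (real_vector g :: nseq n.-1 (real_vector f)).
Proof.
rewrite annihilationE /= size_nseq big_ord_recl /= expr0 mul1r drop0.
rewrite complexification_braket_real; congr (_ + _).
rewrite /qnum mulr_sumr mulr_suml rmorph_sum/= scaler_suml.
apply: eq_bigr => i _; rewrite /= nth_nseq ltn_ord complexification_braket_real.
rewrite rmorphM exprS /=; congr (_ *: fock_tensor G (_ :: _)).
rewrite take_nseq ?(ltnW (ltn_ord i))// drop_nseq -nseqD.
by rewrite /bump /= add0n add1n; congr (nseq _ _); have := ltn_ord i; lia.
Qed.

Lemma creation_pow f n : creation a f (tpow n f) = tpow n.+1 f.
Proof. exact: creationE. Qed.

(** The Hermite recurrence is the action of X_f on tensor powers of a unit vector: X_f f^n = f^(n+1)
    + [n] f^(n-1). *)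
Lemma op_hermite f n : `|f| = 1 ->
  op_horner (hermite q n) (qgaussian a f) Phi = tpow n f.
Proof.
move=> f1; suff /(_ n)[] : forall n,
  op_horner (hermite q n) (qgaussian a f) Phi = tpow n f /\
  op_horner (hermite q n.-1) (qgaussian a f) Phi = tpow n.-1 f by [].
elim=> [|m [IHm IHm1]]; first by rewrite /= /hermite op_horner1.
split=> //; rewrite hermiteS addrC -mulNr -polyCN op_horner_lin op_hornerX.
rewrite IHm IHm1 -[X in _ + X]/(qgaussian a f (tpow m f)) /qgaussian.
rewrite annihilation_pow creation_pow real_braket_unit// mulr1.
by rewrite rmorphN scaleNr addrA addNr add0r.
Qed.

Lemma braket_vacuum : braket Phi Phi = 1.
Proof.
rewrite fock_braketE /qform /= (bigD1 (perm_one 'I_0))//= [X in _ + X]big1;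
  last first.
  by move=> s /negP[]; apply/eqP/permP; case.
rewrite big_ord0 mulr1 addr0 /inversions eq_card0 ?expr0// => -[[]].
by [].
Qed.

(** Peeling off creation operators one by one replaces the sum over permutations; [qcov] obeys the
    same recursion. *)
Lemma braket_pow f h k n :
  braket (tpow k f) (tpow n h) = (qcov q (braket f h) k n)%:C.
Proof.
elim: k n => [|k IHk] n.
  case: n => [|n].
    by rewrite braket_vacuum /qcov /= /qfact big_ord0 mulr1.
  rewrite [RHS]/=; apply: braket_real.
  rewrite -creation_pow creation_adjoint annihilation_pow qnum0 mul0r.
  by rewrite braketZr mul0r.
rewrite -creation_pow creation_adjoint annihilation_pow braketZr IHk -rmorphM.
by rewrite qcovSl; congr _%:C; ring.
Qed.

Lemma braket_pow_cons f g h k n :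
  braket (tpow k f) (fock_tensor G (real_vector g :: nseq n (real_vector h))) =
  (braket f g * [k] * qcov q (braket f h) k.-1 n)%:C.
Proof.
rewrite -(creationE a) annihilation_adjoint annihilation_pow braketZl_real.
rewrite braket_pow -rmorphM (real_braketC g); congr _%:C; ring.
Qed.

Lemma braket_cons_pow f g h k n :
  braket (fock_tensor G (real_vector g :: nseq k (real_vector f))) (tpow n h) =
  (braket g h * [n] * qcov q (braket f h) k n.-1)%:C.
Proof.
rewrite -(creationE a) creation_adjoint annihilation_pow braketZr.
rewrite braket_pow -rmorphM; congr _%:C; ring.
Qed.

Lemma qgaussian_pow f g n : qgaussian a g (tpow n f) =
  ([n] * braket g f)%:C *: tpow n.-1 f +
  fock_tensor G (real_vector g :: nseq n (real_vector f)).
Proof. by rewrite /qgaussian annihilation_pow creationE. Qed.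

Lemma fock_moment1 f g h k n :
  braket (tpow k f) (qgaussian a g (tpow n h)) =
  (braket g h * [n] * qcov q (braket f h) k n.-1 +
   braket f g * [k] * qcov q (braket f h) k.-1 n)%:C.
Proof.
rewrite qgaussian_pow braketDr braketZr braket_pow braket_pow_cons.
by rewrite -rmorphM -rmorphD; congr _%:C; ring.
Qed.

(** Self-adjointness puts one X_g on each side, so that only words with at most one leading g
    occur. *)
Lemma fock_moment2 f g h k n : `|g| = 1 ->
  let M := qcov q (braket f h) in
  let al := braket f g in let be := braket g h in
  braket (tpow k f) (qgaussian a g (qgaussian a g (tpow n h))) =
  ((1 + q) * al * be * [k] * [n] * M k.-1 n.-1 +
   al ^+ 2 * [k] * [k.-1] * M k.-2 n +
   be ^+ 2 * [n] * [n.-1] * M k n.-2 + M k n)%:C.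
Proof.
move=> g1 M al be; rewrite -qgaussian_selfadjoint !qgaussian_pow.
rewrite braketDl !braketDr braketZl_real !braketZr braketZl_real.
rewrite !(braket_pow, braket_pow_cons, braket_cons_pow).
rewrite -[fock_tensor G (_ :: nseq k _)](creationE a) creation_adjoint.
rewrite annihilation_cons_pow real_braket_unit// braketDr !braketZr.
rewrite braket_pow braket_pow_cons (real_braketC g f) -/al -/be -/(M) mul1r.
by rewrite -!(rmorphM, rmorphD)/=; congr _%:C; rewrite /M; ring.
Qed.

End FockMoments.

(** * Classical versions *)

Lemma op_hornerM (R : realType) (V : lmodType R[i]) (T : {linear V -> V})
    (p s : {poly R}) v :
  op_horner (p * s) T v = op_horner p T (op_horner s T v).
Proof.
have op0 u : op_horner 0 T u = 0 by rewrite /op_horner size_poly0 big_ord0.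
elim/poly_ind: p => [|p c IHp]; first by rewrite mul0r !op0.
have -> : (p * 'X + c%:P) * s = c%:P * s + 'X * (p * s) by ring.
have -> : p * 'X + c%:P = c%:P * 1 + 'X * p by ring.
by rewrite !op_horner_lin !op_hornerX op_horner1 IHp.
Qed.

Section Expectation.
Context {R : realType} (d : measure_display) (Omega : measurableType d).
Context (P : probability Omega R).
Local Notation integrable f := (P.-integrable setT (EFin \o f)).
Implicit Types f g : Omega -> R.

Lemma expectation_Rintegral f : fine 'E_P[f]%E = (\int[P]_w f w)%R.
Proof. by rewrite unlock. Qed.

Lemma Rintegral_ge0_ae f : integrable f -> {ae P, forall w, 0 <= f w} ->
  0 <= (\int[P]_w f w)%R.
Proof.
move=> fi f0.
rewrite /Rintegral (@ae_eq_integral _ _ _ _ _ (fun w => `|f w|%:E))//.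
- by apply: fine_ge0; apply: integral_ge0 => w _; rewrite lee_fin.
- exact: measurable_int fi.
- apply/measurable_EFinP.
  apply: (measurableT_comp (@normr_measurable _ setT)) => //.
  by apply/measurable_EFinP; exact: measurable_int fi.
- by apply: filterS f0 => w fw _; rewrite ger0_norm.
Qed.

Lemma Rintegral_sqr_eq0 f : integrable (fun w => f w ^+ 2) ->
  (\int[P]_w (f w ^+ 2))%R = 0 -> {ae P, forall w, f w = 0}.
Proof.
move=> fi f0.
have : (\int[P]_w `|(f w ^+ 2)%:E| = 0)%E.
  under eq_integral do rewrite abse_EFin ger0_norm ?sqr_ge0//.
  by rewrite -[LHS]fineK ?integrable_fin_num// -/(Rintegral _ _ _) f0.
move/(ae_eq_integral_abs _ measurableT (measurable_int _ fi)).
by apply: filterS => w /(_ I)/= [] /eqP; rewrite sqrf_eq0 => /eqP.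
Qed.

End Expectation.

(** For signs u and t one has |u - t| = 1 - u t, and s v is again a sign. *)
Lemma sign_bell (R : realFieldType) (s u v t : R) :
  s = 1 \/ s = -1 -> u = 1 \/ u = -1 -> v = 1 \/ v = -1 ->
  t = 1 \/ t = -1 -> 0 <= 1 - u * t + s * (u - t) * v.
Proof. by do 4![case=> ->]; lra. Qed.

(** * Mixed moments of the classical version and their positivity *)

Section JointMoments.
Context {R : realType} (q : R) (H : realHilbertType R) (f g h : H).
Context (G : qFock q H) (a : fock_operators G).
Context (d : measure_display) (Omega : measurableType d).
Context (P : probability Omega R) (X Y Z : {RV P >-> R}).
Hypotheses (hf : `|f| = 1) (hg : `|g| = 1) (hh : `|h| = 1).
Hypothesis hcl :
  classical_version (qgaussian a f) (qgaussian a g) (qgaussian a h) X Y Z.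
Local Notation integrable f := (P.-integrable setT (EFin \o f)).
Local Notation tpow n f := (fock_tensor G (nseq n (real_vector f))).
Implicit Types A B : {poly {poly R}}.

Definition eval2 A w : R := (A.[(Z w)%:P]).[X w].

Lemma eval2_lin r A B w :
  eval2 (r%:P%:P * A + B) w = r * eval2 A w + eval2 B w.
Proof. by rewrite /eval2 !hornerE. Qed.

Lemma eval2M A B w : eval2 (A * B) w = eval2 A w * eval2 B w.
Proof. by rewrite /eval2 !hornerM. Qed.

Lemma eval2D A B w : eval2 (A + B) w = eval2 A w + eval2 B w.
Proof. by rewrite /eval2 !hornerD. Qed.

Lemma eval2C p w : eval2 p%:P w = p.[X w].
Proof. by rewrite /eval2 hornerC. Qed.

Lemma eval2_lift s w : eval2 s^:P w = s.[Z w].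
Proof. by rewrite /eval2 horner_map hornerC. Qed.

Lemma eval2X w : eval2 'X w = Z w.
Proof. by rewrite /eval2 hornerX hornerC. Qed.

Definition jointf j A w : R := eval2 A w * Y w ^+ j.

(** Expanding A in powers of z leaves finitely many products p1(X) p2(Y) p3(Z), integrable by the
    definition of a classical version. *)
Lemma jointf_integrable j A : integrable (jointf j A).
Proof.
have -> : EFin \o jointf j A = fun w => (\sum_(i < size A)
    ((A`_i).[X w] * ('X^j : {poly R}).[Y w] * ('X^i : {poly R}).[Z w])%:E)%E.
  apply/funext => w; rewrite sumEFin /= /jointf /eval2 [A.[_]]horner_coef.
  congr EFin.
  rewrite horner_sum mulr_suml; apply: eq_bigr => i _.
  by rewrite hornerM !horner_exp hornerC !hornerX mulrAC.
by apply: integrable_sum => // i _; exact: (hcl (A`_i) ('X^j) ('X^i)).1.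
Qed.

Definition joint j A : R := (\int[P]_w jointf j A w)%R.

Lemma joint_lin j : poly2_functional (joint j).
Proof.
move=> r A B; have iA : integrable (fun w => r * jointf j A w).
  exact: (integrableZl measurableT r (jointf_integrable j A)).
rewrite /joint -RintegralZl//; last exact: jointf_integrable.
rewrite -RintegralD//; last exact: jointf_integrable.
by apply: eq_Rintegral => w _; rewrite /jointf eval2_lin; ring.
Qed.

Lemma joint_ge0 A0 A1 A2 :
  {ae P, forall w,
    0 <= eval2 A0 w + eval2 A1 w * Y w + eval2 A2 w * Y w ^+ 2} ->
  0 <= joint 0 A0 + joint 1 A1 + joint 2 A2.
Proof.
move=> pos; have i01 : integrable (fun w => jointf 0 A0 w + jointf 1 A1 w).
  exact: (integrableD measurableT (jointf_integrable 0 A0)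
    (jointf_integrable 1 A1)).
rewrite /joint -RintegralD//; [|exact: jointf_integrable..].
rewrite -RintegralD//; last exact: jointf_integrable.
apply: Rintegral_ge0_ae.
  exact: (integrableD measurableT i01 (jointf_integrable 2 A2)).
by apply: filterS pos => w; rewrite /jointf expr0 expr1 mulr1.
Qed.

Lemma joint01_ge0 A0 A1 :
  {ae P, forall w, 0 <= eval2 A0 w + eval2 A1 w * Y w} ->
  0 <= joint 0 A0 + joint 1 A1.
Proof.
move=> pos; have := @joint_ge0 A0 A1 0.
rewrite (functional0 (joint_lin 2)) addr0; apply; apply: filterS pos => w.
by rewrite [X in _ -> 0 <= _ + X * _]/eval2 !horner0 mul0r addr0.
Qed.

(** Self-adjointness moves p(X_f) onto the left vacuum vector, which leaves the powers of X_g
    between two vectors; this is where the order X, Y, Z enters. *)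
Lemma joint_state j p s : (joint j (p%:P * s^:P))%:C =
  braket (op_horner p (qgaussian a f) (vacuum G))
    (iter j (qgaussian a g) (op_horner s (qgaussian a h) (vacuum G))).
Proof.
have [_] := hcl p ('X^j) s.
rewrite expectation_Rintegral /vacuum_state /= -op_horner_selfadjoint.
have -> v : op_horner ('X^j) (qgaussian a g) v = iter j (qgaussian a g) v.
  elim: j => [|j IHj]; first by rewrite expr0 op_horner1.
  by rewrite exprS op_hornerX IHj.
move=> ->; congr _%:C; apply: eq_Rintegral => w _.
by rewrite /jointf eval2M eval2C eval2_lift !hornerXn mulrAC.
Qed.

Lemma joint0E k n : joint 0 ((hermite q k)%:P * (hermite q n)^:P) =
  qcov q (braket f h) k n.
Proof.
by apply: complexI; rewrite joint_state !op_hermite// (braket_pow a).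
Qed.

Lemma joint1E k n : joint 1 ((hermite q k)%:P * (hermite q n)^:P) =
  braket g h * qnum q n * qcov q (braket f h) k n.-1 +
  braket f g * qnum q k * qcov q (braket f h) k.-1 n.
Proof.
by apply: complexI; rewrite joint_state !op_hermite// fock_moment1.
Qed.

Lemma joint2E k n : let M := qcov q (braket f h) in
  joint 2 ((hermite q k)%:P * (hermite q n)^:P) =
  (1 + q) * braket f g * braket g h * qnum q k * qnum q n * M k.-1 n.-1 +
  braket f g ^+ 2 * qnum q k * qnum q k.-1 * M k.-2 n +
  braket g h ^+ 2 * qnum q n * qnum q n.-1 * M k n.-2 + M k n.
Proof.
by move=> M; apply: complexI; rewrite joint_state !op_hermite// fock_moment2.
Qed.

(** The expectation of ((Y - r X - s Z) phi(X, Z))^2, expanded. *)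
Lemma joint_residual_ge0 (r s : R) phi :
  0 <= joint 2 (phi ^+ 2) -
    2 * (r * joint 1 ('X%:P * phi ^+ 2) + s * joint 1 ('X * phi ^+ 2)) +
    (r ^+ 2 * joint 0 ('X%:P * ('X%:P * phi ^+ 2)) +
     s ^+ 2 * joint 0 ('X * ('X * phi ^+ 2)) +
     2 * r * s * joint 0 ('X%:P * ('X * phi ^+ 2))).
Proof.
set A := phi ^+ 2.
pose A0 := (r ^+ 2)%:P%:P * ('X%:P * ('X%:P * A)) +
  ((s ^+ 2)%:P%:P * ('X * ('X * A)) + (2 * r * s)%:P%:P * ('X%:P * ('X * A))).
pose A1 := (- 2 * r)%:P%:P * ('X%:P * A) + (- 2 * s)%:P%:P * ('X * A).
have : 0 <= joint 0 A0 + joint 1 A1 + joint 2 A.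
  apply: joint_ge0; apply: aeW => w.
  rewrite /A0 /A1 /A !(eval2_lin, eval2D, eval2M) !eval2C.
  rewrite !hornerC hornerX eval2X.
  set E := eval2 phi w.
  by have := sqr_ge0 (((Y w - r * X w - s * Z w) * E)); congr (0 <= _); ring.
rewrite !(functionalD (joint_lin _)) !(functionalZ (joint_lin _)).
by congr (0 <= _); ring.
Qed.

(** The expectation of ((X + Z) phi(X, Z))^2, expanded. *)
Lemma joint_sum_ge0 phi :
  0 <= joint 0 ('X%:P * ('X%:P * phi ^+ 2)) +
    2 * joint 0 ('X%:P * ('X * phi ^+ 2)) +
    joint 0 ('X * ('X * phi ^+ 2)).
Proof.
set A := phi ^+ 2.
pose A0 := 'X%:P * ('X%:P * A) + (2%:P%:P * ('X%:P * ('X * A)) + 'X * ('X * A)).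
have : 0 <= joint 0 A0 + joint 1 0 + joint 2 0.
  apply: joint_ge0; apply: aeW => w.
  rewrite /A0 /A !(eval2_lin, eval2D, eval2M) !eval2C.
  rewrite ?hornerC ?hornerX ?eval2X ?horner0 !mul0r !addr0.
  set E := eval2 phi w.
  by have := sqr_ge0 (((X w + Z w) * E)); congr (0 <= _); ring.
rewrite !(functional0 (joint_lin _)) !(functionalD (joint_lin _)).
by rewrite (functionalZ (joint_lin _)); congr (0 <= _); ring.
Qed.

(** * The fermionic case q = -1 *)

Lemma hermite2 : hermite q 2 = 'X * 'X - 1.
Proof.
by rewrite !hermiteS qnum0 qnumSl qnum0 mulr0 addr0 /= /hermite; ring.
Qed.

(** For q = -1 one has [2] = 0, so the tensor square of f' is a null vector and H_2(X_f') kills the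
    vacuum. *)
Lemma fock_hermite_sqr f' : q = -1 -> `|f'| = 1 -> braket (vacuum G)
  (op_horner (hermite q 2 * hermite q 2) (qgaussian a f') (vacuum G)) = 0.
Proof.
move=> qN1 f1; rewrite op_hornerM -op_horner_selfadjoint !op_hermite//.
rewrite (braket_pow a) /qcov eqxx qfactS qnumSl qnumSl qnum0 qN1.
by rewrite mulr0 addr0 mulr1 subrr mul0r mulr0.
Qed.

(** The second moment of H_2(W) = W^2 - 1 vanishes. A generic [W] lets the argument serve X, Y and Z
    alike. *)
Lemma sqr_ae_eq1 (f' : H) (W : Omega -> R) :
  q = -1 -> `|f'| = 1 ->
  (integrable (fun w => (W w ^+ 2 - 1) ^+ 2) /\
  braket (vacuum G)
    (op_horner (hermite q 2 * hermite q 2) (qgaussian a f') (vacuum G)) =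
  (fine 'E_P[(fun w => (W w ^+ 2 - 1) ^+ 2)%R]%E)%:C) ->
  {ae P, forall w, W w = 1 \/ W w = -1}.
Proof.
move=> qN1 f1 [Wi]; rewrite fock_hermite_sqr// expectation_Rintegral => e.
have := Rintegral_sqr_eq0 Wi (esym (complexI e)).
apply: filterS => w /eqP; rewrite subr_eq0 sqrf_eq1 => /orP[]/eqP; tauto.
Qed.

Lemma fermionic_ae_sign : q = -1 -> {ae P, forall w,
  [/\ X w = 1 \/ X w = -1, Y w = 1 \/ Y w = -1 & Z w = 1 \/ Z w = -1]}.
Proof.
move=> qN1; pose p := hermite q 2 * hermite q 2.
have pE t : p.[t] = (t ^+ 2 - 1) ^+ 2 by rewrite /p hermite2 !hornerE; ring.
have aX : {ae P, forall w, X w = 1 \/ X w = -1}.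
  apply: (sqr_ae_eq1 qN1 hf); have := hcl p 1 1.
  rewrite /vacuum_state /= !op_horner1.
  by under eq_fun do rewrite pE !hornerC !mulr1.
have aY : {ae P, forall w, Y w = 1 \/ Y w = -1}.
  apply: (sqr_ae_eq1 qN1 hg); have := hcl 1 p 1.
  rewrite /vacuum_state /= !op_horner1.
  by under eq_fun do rewrite pE !hornerC mul1r mulr1.
have aZ : {ae P, forall w, Z w = 1 \/ Z w = -1}.
  apply: (sqr_ae_eq1 qN1 hh); have := hcl 1 1 p.
  rewrite /vacuum_state /= !op_horner1.
  by under eq_fun do rewrite pE !hornerC !mul1r.
by apply: filterS3 aX aY aZ => w; split.
Qed.

(** Almost surely |(X - Z) Y| <= 1 - X Z for signs. Taking expectations with s = 1 and s = -1 gives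
    the two halves of the absolute value. *)
Lemma fermionic_bell : q = -1 ->
  `|braket f g - braket g h| <= 1 - braket f h.
Proof.
move=> qN1; have ae := fermionic_ae_sign qN1.
have HX1 : hermite q 1 = 'X by rewrite hermiteS qnum0 /hermite; ring.
have H0 : hermite q 0 = 1 by [].
have M00 c : qcov q c 0 0 = 1 by rewrite /qcov /= /qfact big_ord0 mulr1.
have q1 : qnum q 1 = 1 by rewrite qnumSl qnum0 mulr0 addr0.
have E0 : joint 0 1 = 1.
  by have := joint0E 0 0; rewrite H0 !rmorph1 mulr1 M00.
have EXZ : joint 0 ('X%:P * 'X) = braket f h.
  have := joint0E 1 1; rewrite HX1 map_polyX => ->.
  by rewrite qcovSl /= q1 M00 !mulr1.
have EX : joint 1 'X%:P = braket f g.
  have := joint1E 1 0; rewrite HX1 H0 rmorph1 mulr1 => ->.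
  by rewrite qnum0 q1 M00; ring.
have EZ : joint 1 'X = braket g h.
  have := joint1E 0 1; rewrite HX1 H0 map_polyX rmorph1 mul1r => ->.
  by rewrite qnum0 q1 M00; ring.
have bell s : s = 1 \/ s = -1 ->
    0 <= 1 - braket f h + s * (braket f g - braket g h).
  move=> hs; pose A0 : {poly {poly R}} := 1 - 'X%:P * 'X.
  pose A1 : {poly {poly R}} := s%:P%:P * ('X%:P - 'X).
  have : 0 <= joint 0 A0 + joint 1 A1.
    apply: joint01_ge0; apply: filterS ae => w [hX hY hZ].
    rewrite /A0 /A1 eval2D eval2M /eval2 !hornerE.
    exact: sign_bell.
  rewrite (functionalZ (joint_lin _)).
  rewrite !(functionalD (joint_lin _)) !(functionalN (joint_lin _)).
  by rewrite E0 EXZ EX EZ.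
have := bell 1 (or_introl erefl); have := bell (-1) (or_intror erefl).
by rewrite ler_norml => ? ?; apply/andP; split; lra.
Qed.

End JointMoments.

Theorem theorem3 (R : realType) (q : R) (hq : -1 <= q < 1)
  (H : realHilbertType R) (f g h : H)
  (hf : `|f| = 1) (hg : `|g| = 1) (hh : `|h| = 1)
  (hfree : forall a b : R, a *: f + b *: h = 0 -> a = 0 /\ b = 0)
  (G : qFock q H) (a : fock_operators G)
  (d : measure_display) (Omega : measurableType d) (P : probability Omega R)
  (X Y Z : {RV P >-> R})
  (hcl : classical_version (qgaussian a f) (qgaussian a g) (qgaussian a h)
           X Y Z)
  (hcase : (braket f g * braket g h <= braket f h /\ 0 < braket f h < 1) \/
           braket f h = 0 \/ q = -1) :
  `|braket f g - braket g h| <= 1 - braket f h.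
Proof.
(* The spread argument needs powers of q tending to 0, so q = -1 is split off. *)
have [qE|qN1] := eqVneq q (-1); first exact: fermionic_bell hf hg hh hcl qE.
have [q_ge q_lt] := andP hq.
have q_gt : -1 < q by rewrite lt_neqAle eq_sym qN1.
(* Both remaining cases lie in the range 0 <= <f,h> < 1 of [bell_functional]. *)
have [c_ge c_lt] : 0 <= braket f h /\ braket f h < 1.
  case: hcase => [[_ /andP[c0 c1]]|[->|/eqP]]; last by rewrite (negbTE qN1).
    by split=> //; exact: ltW.
  by split.
exact: (bell_functional (al := braket f g) (be := braket g h) q_gt q_lt c_ge
  c_lt (joint_lin hcl 0) (joint_lin hcl 1) (joint_lin hcl 2)
  (joint0E hf hh hcl) (joint1E hf hh hcl) (joint2E hf hg hh hcl)
  (joint_residual_ge0 hcl) (joint_sum_ge0 hcl)).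
Qed.
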